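(* Let $b>1$ be a rational number and $d\in\{-163,-67,-43,-19,-11,-7,-3,-2,-1\}$. Let $U(b)=\{n\in\mathbb{N}:\sigma^*(n)=bn\}$ and $V_d(b)=\{z\in A(d): I_1^*(z)=b\}$, where $I_1^*$ is computed in $\mathcal O_{\mathbb{Q}(\sqrt{d})}$. Then there exists an injective function $g:U(b)\to V_d(b)$.
   Context: For a positive integer $n$, $\sigma^*(n)$ is the sum of the unitary divisors of $n$, i.e. of the positive divisors $c$ of $n$ with $\gcd(c,n/c)=1$. $\mathcal O_{\mathbb{Q}(\sqrt{d})}$ is $\mathbb{Z}[\frac{1+\sqrt d}{2}]$ if $d\equiv 1 \pmod 4$ and $\mathbb{Z}[\sqrt d]$ if $d\equiv 2,3\pmod 4$; for the listed $d$ it is a unique factorization domain. $|z|=\sqrt{z\bar z}$, $\arg(z)\in[0,2\pi)$. $A(d)$ is the set of nonzero $z\in\mathcal O_{\mathbb{Q}(\sqrt{d})}$ with $0\le\arg(z)<\pi/2$ if $d=-1$, with $0\le \arg(z)<\pi/3$ if $d=-3$, and with $0\le\arg(z)<\pi$ otherwise. Two elements are relatively prime if they have no nonunit common divisor. For nonzero $x,z$, write $x\Diamond z$ iff $x\in A(d)$, $x\mid z$, and $x$ is relatively prime to $z/x$. Define $\delta_1^*(z)=\sum_{x\Diamond z}|x|$ and $I_1^*(z)=\delta_1^*(z)/|z|$. *)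

(* Defs.v *)
From HB Require Import structures.
From mathcomp Require Import all_boot all_order all_algebra.
From mathcomp Require Import boolp classical_sets fsbigop reals trigo.
From mathcomp Require Import complex.

Set Implicit Arguments.
Unset Strict Implicit.
Unset Printing Implicit Defensive.

Import Order.TTheory GRing.Theory Num.Theory.
Local Open Scope ring_scope.
Local Open Scope classical_set_scope.

Definition usigma (n : nat) : nat :=
  (\sum_(c <- divisors n | coprime c (n %/ c)) c)%N.

Section Quadratic.
Variable R : realType.
Local Notation C := R[i].

(* sqrt d as a complex number, for d < 0 (all d considered are negative):
   sqrt d = i * sqrt(-d). *)
Definition sqrtd (d : int) : C := Complex 0 (Num.sqrt (- (d%:~R : R))).

(* generator of the ring of integers O_{Q(sqrt d)} over Z *)
Definition omega (d : int) : C :=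
  if ((d %% 4)%Z == 1) then (1 + sqrtd d) / 2%:R else sqrtd d.

Definition inO (d : int) (z : C) : Prop :=
  exists a b : int, z = a%:~R + b%:~R * omega d.

Definition dvdO (d : int) (x z : C) : Prop :=
  exists2 y, inO d y & z = x * y.

Definition unitO (d : int) (u : C) : Prop :=
  inO d u /\ exists2 v, inO d v & u * v = 1.

Definition relprimeO (d : int) (x y : C) : Prop :=
  forall c, inO d c -> dvdO d c x -> dvdO d c y -> unitO d c.

Definition absC (z : C) : R := ComplexField.Normc.normc z.

(* "arg(z) < hi", arg(z) in [0, 2pi): there is theta in [0, hi) with
   z = |z| (cos theta + i sin theta).  For z <> 0 and hi <= 2 pi this is
   exactly 0 <= arg z < hi. *)
Definition arg_lt (z : C) (hi : R) : Prop :=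
  exists theta : R, 0 <= theta /\ theta < hi /\
    complex.Re z = absC z * cos theta /\ complex.Im z = absC z * sin theta.

Definition arg_bound (d : int) : R :=
  if d == -1 then pi / 2%:R else if d == -3 then pi / 3%:R else pi.

Definition inA (d : int) (z : C) : Prop :=
  inO d z /\ z != 0 /\ arg_lt z (arg_bound d).

Definition diamond (d : int) (x z : C) : Prop :=
  inA d x /\ dvdO d x z /\ relprimeO d x (z / x).

Definition delta1s (d : int) (z : C) : R :=
  \sum_(x \in [set x | diamond d x z]) absC x.

Definition I1s (d : int) (z : C) : R := delta1s d z / absC z.

Definition Vset (d : int) (b : rat) : set C :=
  [set z | inA d z /\ I1s d z = ratr b].

End Quadratic.

Definition Uset (b : rat) : set nat :=
  [set n | (0 < n)%N /\ ((usigma n)%:R = b * n%:R :> rat)].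

Definition heegner_list : seq int := [:: -163; -67; -43; -19; -11; -7; -3; -2; -1].

(* Main.v *)
(* A rational prime [p] is, up to a unit, [P ^ e] for a prime [P] of the ring of
   integers when it is inert ([e = 1]) or ramified ([e = 2]); if it splits,
   [P ^ 2] still has modulus [p] when [P] lies above [p].  Sending each [p] to
   the corresponding prime power of modulus [p] extends to a multiplicative map
   [n |-> z_n] with [|z_n| = n], under which, up to units, the unitary divisors
   of [z_n] are exactly the [z_c] for [c] a unitary divisor of [n].  Hence the
   unitary divisor sums of [n] and [z_n] agree, and [|z_n| = n] makes the map
   injective.  The hypothesis on [d] enters through Gauss reduction: a prime
   that is not inert is a norm. *)
Require Import Defs.
From HB Require Import structures.
From mathcomp Require Import all_boot all_order all_algebra.
From mathcomp Require Import boolp classical_sets fsbigop reals trigo.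
From mathcomp Require Import complex.
From mathcomp Require Import zify ring lra.
Import Order.TTheory GRing.Theory Num.Theory.
Local Open Scope ring_scope.

(** * Reduction of binary quadratic forms *)

(** [omega] is a root of X^2 - tX + m, with t its trace and m its norm, and t^2 - 4m is the
    discriminant of the field. Both classes of [d] modulo 4 then share the same formulas. *)
Definition tr_omega (d : int) : int := if (d %% 4)%Z == 1 then 1 else 0.
Definition nm_omega (d : int) : int :=
  if (d %% 4)%Z == 1 then ((1 - d) %/ 4)%Z else - d.
(* [qnorm d x y] is the norm of [x + y omega], and [qtrace d x y z w] the trace
   of [(x + y omega)] times the conjugate of [(z + w omega)]. *)
Definition qnorm (d x y : int) : int :=
  x ^+ 2 + tr_omega d * x * y + nm_omega d * y ^+ 2.
Definition qtrace (d x y z w : int) : int :=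
  2 * x * z + tr_omega d * (x * w + y * z) + 2 * nm_omega d * y * w.

Lemma disc_bounds (d : int) : d \in heegner_list ->
  0 < 4 * nm_omega d - tr_omega d ^+ 2 <= 163.
Proof.
have /allP H : all (fun d => 0 < 4 * nm_omega d - tr_omega d ^+ 2 <= 163)
  heegner_list by vm_compute.
exact: H.
Qed.

(* A reduced form [(a, b, c)] of discriminant [-q] has [3 a ^ 2 <= q], and
   [q <= 163] then gives [a <= 7]. *)
Definition no_small_form (q : nat) : bool :=
  all (fun a => all (fun b =>
      ~~ (4 * a %| b ^ 2 + q)%N || (b ^ 2 + q < 4 * a ^ 2)%N)
    (iota 0 a.+1)) (iota 2 6).

(** This is the verification of class number one: the finite search over reduced forms is run for
    each of the nine discriminants. *)
Lemma heegner_no_small_form (d : int) : d \in heegner_list ->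
  no_small_form (absz (4 * nm_omega d - tr_omega d ^+ 2)%R).
Proof.
have /allP H : all
    (fun d => no_small_form (absz (4 * nm_omega d - tr_omega d ^+ 2)%R))
  heegner_list by vm_compute.
exact: H.
Qed.

Lemma no_small_formP (q : nat) (A B C : int) : no_small_form q -> (q <= 163)%N ->
  q%:Z = 4 * A * C - B ^+ 2 -> 0 < A -> `|B| <= A -> A <= C -> A = 1.
Proof.
move=> chk q163 qE A0 BA AC.
have B2 : B ^+ 2 <= A ^+ 2 by nia.
have A2C : A ^+ 2 <= A * C by rewrite expr2 ler_pM2l.
have A7 : A <= 7.
  case: (lerP A 7) => // A8; have : 64 <= A ^+ 2 by nia.
  lia.
case: (eqVneq A 1) => // A1.
have Ain : (absz A) \in iota 2 6 by rewrite mem_iota; lia.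
have Bin : (absz B) \in iota 0 (absz A).+1 by rewrite mem_iota; lia.
(* C = (B^2 + q) / (4A) is an integer and at least A, so the search would have met this form; only
   |B| matters to it. *)
move/allP: chk => /(_ _ Ain) /allP /(_ _ Bin).
have E : (absz B ^ 2 + q = 4 * absz A * absz C)%N.
  apply/eqP; rewrite -eqz_nat; apply/eqP; nia.
rewrite E dvdn_mulr //=; nia.
Qed.

Lemma reduced_form (d A B C : int) : d \in heegner_list ->
  tr_omega d ^+ 2 - 4 * nm_omega d = B ^+ 2 - 4 * A * C ->
  0 < A -> `|B| <= A -> A <= C -> A = 1.
Proof.
move=> dH HD; have := disc_bounds d dH; have := heegner_no_small_form d dH.
move: (tr_omega d) (nm_omega d) HD => t m HD chk bnd.
by apply: (no_small_formP _ _ _ C chk); lia.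
Qed.

Lemma trace_parity (t b e : int) : t = 0 \/ t = 1 ->
  t ^+ 2 - 4 * e = b ^+ 2 -> exists j, b = 2 * j + t.
Proof.
move=> t01 E; exists ((b - t) %/ 2)%Z; have := divz_eq (b - t) 2.
have [i Ei] : exists i, b ^+ 2 - t = 2 * i by exists (- (2 * e)); case: t01 E; lia.
by case: t01 Ei {E} => ->; nia.
Qed.

Lemma tr_omega01 (d : int) : tr_omega d = 0 \/ tr_omega d = 1.
Proof. by rewrite /tr_omega; case: ifP; [right|left]. Qed.

(* Carrying ring elements along the reduction steps avoids any notion of
   equivalence of forms: the form is that of [N (X alpha + Y gamma)], where
   [alpha = x + y omega] and [gamma = z + w omega]. *)
Lemma form_represented (d A B C : int) : d \in heegner_list ->
  tr_omega d ^+ 2 - 4 * nm_omega d = B ^+ 2 - 4 * A * C -> 0 < A ->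
  exists x y z w,
    [/\ A = qnorm d x y, C = qnorm d z w & B = qtrace d x y z w].
Proof.
move=> dH; have [n] := ubnP (absz A); elim: n A B C => // n IH A B C An HD A0.
have D0 : tr_omega d ^+ 2 - 4 * nm_omega d < 0.
  by have := disc_bounds d dH; lia.
(* [k] is B / (2A) rounded to a nearest integer: replacing gamma by gamma - k alpha keeps A and
   brings the middle coefficient into [-A, A]. *)
pose k := ((B + A) %/ (2 * A))%Z.
pose B' := B - 2 * A * k.
pose C' := C - B * k + A * k ^+ 2.
have B'A : `|B'| <= A.
  have := divz_eq (B + A) (2 * A); have := modz_ge0 (B + A) (d := 2 * A).
  have := ltz_mod (B + A) (d := 2 * A); rewrite -/k /B'; nia.
have HD' : tr_omega d ^+ 2 - 4 * nm_omega d = B' ^+ 2 - 4 * A * C'.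
  by rewrite HD /B' /C'; ring.
suff [x [y [z [w [EA EC EB]]]]] : exists x y z w,
    [/\ A = qnorm d x y, C' = qnorm d z w & B' = qtrace d x y z w].
  exists x, y, (z + k * x), (w + k * y); split => //.
    have -> : C = C' + k * B' + k ^+ 2 * A by rewrite /B' /C'; ring.
    by rewrite EC EB EA /qnorm /qtrace; ring.
  have -> : B = B' + 2 * k * A by rewrite /B'; ring.
  by rewrite EB EA /qnorm /qtrace; ring.
clearbody B' C'; clear k HD.
have C'0 : 0 < C'.
  have: 0 < A * C' by have := sqr_ge0 B'; lia.
  by rewrite pmulr_rgt0.
(* If A <= C', the form is reduced, so A = 1, and alpha = 1, gamma = j + omega realize it. Otherwise
   exchanging alpha and gamma lowers the first coefficient, and the induction applies. *)
case: (lerP A C') => [AC|CA].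
  have A1 := reduced_form _ _ _ _ dH HD' A0 B'A AC.
  have E : tr_omega d ^+ 2 - 4 * (nm_omega d - C') = B' ^+ 2.
    by move: HD'; rewrite A1; lia.
  have [j Ej] := trace_parity _ _ _ (tr_omega01 d) E.
  exists 1, 0, j, 1; rewrite A1 /qnorm /qtrace; split; try by rewrite ?Ej; ring.
  by apply: (@mulfI _ 4) => //; move: E; rewrite Ej; lia.
have [||x [y [z [w [EA EC EB]]]]] := IH C' B' A _ _ C'0.
- lia.
- by rewrite HD'; ring.
by exists z, w, x, y; split=> //; rewrite EB /qtrace; ring.
Qed.

(** A root a of N(X + omega) modulo p makes p the first coefficient of a form with the discriminant
    of the norm form, hence a norm. Without a root, p | N(x + y omega) forces p | y and then p |
    x^2. *)
Lemma prime_norm_or_inert (d : int) (p : nat) : d \in heegner_list -> prime p ->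
  (exists x y, p%:Z = qnorm d x y) \/
  (forall x y, (p%:Z %| qnorm d x y)%Z -> (p%:Z %| x)%Z /\ (p%:Z %| y)%Z).
Proof.
move=> dH pp.
case: (boolP [exists a : 'I_p, (p%:Z %| qnorm d (a : nat)%:Z 1)%Z]).
  move=> /existsP [a /dvdzP [C EC]]; left.
  (* With N(a + omega) = pC, the form (p, 2a + t, C) is N(pX + (a + omega)Y) / p. *)
  have [||x [y [_ [_ [E _ _]]]]] :=
    form_represented d p (2 * (a : nat)%:Z + tr_omega d) C dH.
  - have -> : 4 * p%:Z * C = 4 * qnorm d (a : nat)%:Z 1 by rewrite EC; ring.
    by rewrite /qnorm; ring.
  - by have := prime_gt0 pp; lia.
  by exists x, y.
rewrite negb_exists => /forallP noroot; right=> x y pxy.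
have pdvd : forall a b : int, (p%:Z %| a * b)%Z -> (p%:Z %| a)%Z || (p%:Z %| b)%Z.
  by move=> a b; rewrite !dvdzE abszM /= Euclid_dvdM.
have py : (p%:Z %| y)%Z.
  (* the inverse [u] of [y] modulo [p] would make [u x] a root *)
  apply/negP => /negP pNy.
  have [u [v uv]] : exists u v : int, u * y + v * p = 1.
    have /eqP cop : coprimez y p by rewrite coprimezE /= coprime_sym prime_coprime // -dvdzE.
    by have [u [v E]] := Bezoutz y p; exists u, v; rewrite E cop.
  have p0 : p%:Z != 0 by have := prime_gt0 pp; lia.
  have rlt : (absz (u * x %% p)%Z < p)%N.
    by have := ltz_pmod (u * x) (d := p); have := modz_ge0 (u * x) p0; have := prime_gt0 pp; lia.
  have := noroot (Ordinal rlt); apply/negP; rewrite negbK /=.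
  have -> : (absz (u * x %% p)%Z)%:Z = u * x - (u * x %/ p)%Z * p.
    by have := divz_eq (u * x) p; have := modz_ge0 (u * x) p0; lia.
  set k := (u * x %/ p)%Z.
  (* [g] is the cofactor of p in N(ux - kp + omega) - u^2 N(x + y omega), found by writing 1 = uy +
     vp. *)
  set g := k * (k * p%:Z - 2 * u * x - tr_omega d) +
    v * (tr_omega d * u * x + nm_omega d * (1 + u * y)).
  have -> : qnorm d (u * x - k * p) 1 = u ^+ 2 * qnorm d x y + p%:Z * g.
    have -> : u ^+ 2 * qnorm d x y + p%:Z * g =
      (u * x - k * p) ^+ 2 - tr_omega d * k * p +
      tr_omega d * u * x * (u * y + v * p) +
      nm_omega d * ((u * y) ^+ 2 + (v * p) * (1 + u * y))
      by rewrite /g /qnorm; ring.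
    have -> : v * p = 1 - u * y by rewrite -uv; ring.
    by rewrite /qnorm; ring.
  by apply: rpredD; [exact: dvdz_mull | exact/dvdz_mulr/dvdzz].
split=> //.
have : (p%:Z %| x * x)%Z.
  have -> : x * x = qnorm d x y - y * (tr_omega d * x + nm_omega d * y).
    by rewrite /qnorm; ring.
  by rewrite rpredB // dvdz_mulr.
by move/pdvd; rewrite orbb.
Qed.

(** * Primes of the ring of integers *)

Section Modulus.
Context {R : realType}.
Implicit Types z w : R[i].

Lemma absC_sqr z : absC z ^+ 2 = complex.Re z ^+ 2 + complex.Im z ^+ 2.
Proof. by case: z => a b /=; rewrite sqr_sqrtr // addr_ge0 ?sqr_ge0. Qed.

Lemma absC_ge0 z : 0 <= absC z.
Proof. by case: z => a b; exact: sqrtr_ge0. Qed.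

Lemma absC_eq0 z : (absC z == 0) = (z == 0).
Proof.
apply/eqP/eqP => [/ComplexField.Normc.eq0_normc //|->].
exact: ComplexField.Normc.normc0.
Qed.

Lemma absCM z w : absC (z * w) = absC z * absC w.
Proof. exact: ComplexField.Normc.normcM. Qed.

Lemma absC1 : absC (1 : R[i]) = 1.
Proof. exact: ComplexField.Normc.normc1. Qed.

Lemma absCX z n : absC (z ^+ n) = absC z ^+ n.
Proof. by elim: n => [|n IH]; rewrite ?expr0 ?absC1 // !exprS absCM IH. Qed.

Lemma absC_nat n : absC (n%:R : R[i]) = n%:R.
Proof.
have -> : (n%:R : R[i]) = (n%:R : R)%:C%C by rewrite rmorph_nat.
by rewrite /absC /= expr0n addr0 sqrtr_sqr ger0_norm.
Qed.

Lemma mul_conjc z : z * (z^*)%C = (absC z ^+ 2)%:C%C.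
Proof.
rewrite absC_sqr; case: z => a b; apply/eqP; rewrite eq_complex /=.
by apply/andP; split; apply/eqP; ring.
Qed.

Lemma Re_intr (a : int) : complex.Re (a%:~R : R[i]) = a%:~R.
Proof. by rewrite -(rmorph_int (real_complex R)). Qed.

Lemma Im_intr (a : int) : complex.Im (a%:~R : R[i]) = 0.
Proof. by rewrite -(rmorph_int (real_complex R)). Qed.

End Modulus.

(** * Coordinates in the integral basis [1], [omega] *)

Section RingOfIntegers.
Variables (R : realType) (d : int).
Hypothesis dH : d \in heegner_list.
Local Notation C := R[i].
Local Notation w := (omega R d).
Local Notation t := (tr_omega d).
Local Notation m := (nm_omega d).
Implicit Types (x y z u : C) (a b : int).

Lemma omega_ReIm : [/\ 2 * complex.Re w = t%:~R, 0 < complex.Im w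
  & complex.Re w ^+ 2 + complex.Im w ^+ 2 = m%:~R].
Proof.
have d0 : d < 0.
  have /allP H : all (fun d => d < 0) heegner_list by vm_compute.
  exact: H.
have s0 : 0 < Num.sqrt (- d%:~R : R) by rewrite sqrtr_gt0 oppr_gt0 ltrz0.
have s2 : Num.sqrt (- d%:~R : R) ^+ 2 = - d%:~R.
  by rewrite sqr_sqrtr // oppr_ge0 lerz0 ltW.
rewrite /omega /tr_omega /nm_omega /sqrtd; case: ifP => [/eqP d1|_].
  move: s0 s2; set s := Num.sqrt _ => s0 s2.
  have -> : (1 + Complex 0 s) / 2%:R = Complex (2^-1) (s / 2) :> C.
    apply: (@mulIf _ 2%:R); rewrite ?pnatr_eq0 // divfK ?pnatr_eq0 //.
    have -> : (2%:R : C) = Complex 2%:R 0 by rewrite -(rmorph_nat (real_complex R)).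
    by apply/eqP; rewrite eq_complex /=; apply/andP; split; apply/eqP; field.
  split=> /=.
  - by rewrite divff ?pnatr_eq0.
  - by apply: divr_gt0.
  have Ed : d = 1 - 4 * ((1 - d) %/ 4)%Z.
    by have := divz_eq (1 - d) 4; have := divz_eq d 4; rewrite d1; lia.
  rewrite !expr_div_n s2; move: ((1 - d) %/ 4)%Z Ed => k {1}->.
  by rewrite rmorphB rmorphM /=; field.
by split=> //=; rewrite ?mulr0 // expr0n add0r s2 rmorphN.
Qed.

Definition qint a b : C := a%:~R + b%:~R * w.

Lemma Im_omega_gt0 : 0 < complex.Im w. Proof. by have [] := omega_ReIm. Qed.

Lemma Re_qint a b : complex.Re (qint a b) = a%:~R + b%:~R * complex.Re w.
Proof.
rewrite raddfD /= Re_intr; congr (_ + _).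
have := Re_intr (R := R) b; have := Im_intr (R := R) b.
by case: (b%:~R) => ? ? /= -> ->; case: w => ? ? /=; rewrite mul0r subr0.
Qed.

Lemma Im_qint a b : complex.Im (qint a b) = b%:~R * complex.Im w.
Proof.
rewrite raddfD /= Im_intr add0r.
have := Re_intr (R := R) b; have := Im_intr (R := R) b.
by case: (b%:~R) => ? ? /= -> ->; case: w => ? ? /=; rewrite mul0r addr0.
Qed.

Lemma absC_qint a b : absC (qint a b) ^+ 2 = (qnorm d a b)%:~R.
Proof.
have [E1 _ E2] := omega_ReIm.
rewrite absC_sqr Re_qint Im_qint /qnorm !(rmorphD, rmorphM, rmorphXn) /=.
by rewrite -E1 -E2; ring.
Qed.

Lemma qint_inj a b a' b' : qint a b = qint a' b' -> a = a' /\ b = b'.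
Proof.
move=> E; have := congr1 (@complex.Im R) E; rewrite !Im_qint.
move/(mulIf (lt0r_neq0 Im_omega_gt0))/intr_inj => Eb; split=> //.
have := congr1 (@complex.Re R) E; rewrite !Re_qint Eb.
by move/addIr/intr_inj.
Qed.

Lemma conj_omega : (w^*)%C = t%:~R - w.
Proof.
have [E1 _ _] := omega_ReIm.
apply/eqP; rewrite eq_complex !raddfB /= Re_intr Im_intr -E1.
by case: w => p q /=; apply/andP; split; apply/eqP; ring.
Qed.

Lemma omega_sqr : w ^+ 2 = t%:~R * w - m%:~R.
Proof.
have [_ _ E] := omega_ReIm.
have := mul_conjc w; rewrite conj_omega absC_sqr E rmorph_int => <-.
by ring.
Qed.

Lemma inO_qint a b : inO d (qint a b). Proof. by exists a, b. Qed.

Lemma inO_int a : inO d (a%:~R : C).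
Proof. by exists a, 0; rewrite mul0r addr0. Qed.

Lemma inO1 : inO d (1 : C). Proof. exact: (inO_int 1). Qed.

Lemma inOD x y : inO d x -> inO d y -> inO d (x + y).
Proof.
move=> [a [b ->]] [a' [b' ->]]; exists (a + a'), (b + b').
by rewrite !rmorphD /=; ring.
Qed.

Lemma qint_mul a b a' b' : qint a b * qint a' b' =
  qint (a * a' - b * b' * m) (a * b' + b * a' + b * b' * t).
Proof.
have -> : qint a b * qint a' b' =
  a%:~R * a'%:~R + (a%:~R * b'%:~R + b%:~R * a'%:~R) * w +
  b%:~R * b'%:~R * w ^+ 2 by rewrite /qint; ring.
by rewrite omega_sqr /qint !(rmorphD, rmorphB, rmorphM) /=; ring.
Qed.

Lemma inOM x y : inO d x -> inO d y -> inO d (x * y).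
Proof.
by move=> [a [b ->]] [a' [b' ->]]; rewrite -!/(qint _ _) qint_mul; apply: inO_qint.
Qed.

Lemma inON x : inO d x -> inO d (- x).
Proof.
move=> [a [b ->]]; exists (- a), (- b).
by rewrite !rmorphN /=; ring.
Qed.

Lemma inOX x n : inO d x -> inO d (x ^+ n).
Proof.
by move=> xO; elim: n => [|n IH]; [exact: inO1 | rewrite exprS; exact: inOM].
Qed.

Lemma inO_conj x : inO d x -> inO d ((x^*)%C).
Proof.
move=> [a [b ->]]; exists (a + b * t), (- b).
rewrite rmorphD rmorphM /= !rmorph_int /= conj_omega rmorphD rmorphM rmorphN /=.
by ring.
Qed.

Lemma absC_inO x : inO d x -> exists n : nat, absC x ^+ 2 = n%:R.
Proof.
move=> [a [b ->]]; have E := absC_qint a b.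
have: (0 : R) <= (qnorm d a b)%:~R by rewrite -E sqr_ge0.
by rewrite ler0z => /gez0_abs q0; exists (absz (qnorm d a b)); rewrite E -q0.
Qed.

(** Squared moduli are natural numbers, and two of them with product 1 are both 1. Conversely, for
    modulus 1 the conjugate is an inverse. *)
Lemma unitO_absC u : inO d u -> unitO d u <-> absC u = 1.
Proof.
move=> uO; split=> [[_ [v vO uv]]|u1].
  have [k Ek] := absC_inO _ uO; have [l El] := absC_inO _ vO.
  have : absC u ^+ 2 * absC v ^+ 2 = 1 by rewrite -exprMn -absCM uv absC1 expr1n.
  rewrite Ek El -natrM => /eqP; rewrite pnatr_eq1 muln_eq1 => /andP [/eqP k1 _].
  by apply/eqP; rewrite -sqrp_eq1 ?absC_ge0 // Ek k1.
split=> //; exists ((u^*)%C); first exact: inO_conj.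
by rewrite mul_conjc u1 expr1n.
Qed.

(** Moduli can be irrational, but their squares are natural numbers and multiplicative, which
    carries divisibility over to the natural numbers. *)
Lemma dvdO_absC (k l : nat) x y : absC x ^+ 2 = k%:R -> absC y ^+ 2 = l%:R ->
  dvdO d x y -> (k %| l)%N.
Proof.
move=> Ek El [z /absC_inO [j Ej] E]; move: El; rewrite E absCM exprMn Ek Ej.
by rewrite -natrM => /eqP; rewrite eqr_nat => /eqP <-; rewrite dvdn_mulr.
Qed.

(** Only the divisibility property is recorded; that the primes in use are nonzero nonunits is read
    off from moduli in [P_neq0] and [P_nonunit]. *)
Definition primeO x := inO d x /\ forall y z, inO d y -> inO d z ->
  dvdO d x (y * z) -> dvdO d x y \/ dvdO d x z.

Lemma dvdO_mulr x y z : inO d z -> dvdO d x y -> dvdO d x (y * z).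
Proof.
by move=> zO [v vO ->]; exists (v * z); rewrite ?mulrA //; exact: inOM.
Qed.

Lemma dvdO_add x y z : dvdO d x y -> dvdO d x z -> dvdO d x (y + z).
Proof.
by move=> [v vO ->] [v' vO' ->]; exists (v + v'); rewrite ?mulrDr //; exact: inOD.
Qed.

Lemma dvdO_int (p : nat) a b :
  dvdO d (p%:R : C) (qint a b) <-> (p%:Z %| a)%Z /\ (p%:Z %| b)%Z.
Proof.
split.
  move=> [_ [k [l ->]] E].
  have [] := qint_inj a b (p%:Z * k) (p%:Z * l).
    by rewrite E /qint !rmorphM /=; ring.
  by move=> -> ->; rewrite !dvdz_mulr.
move=> [/dvdzP [k ->] /dvdzP [l ->]]; exists (qint k l); first exact: inO_qint.
by rewrite /qint !rmorphM /=; ring.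
Qed.

(** If p | yz, then p^2 | N(y) N(z), so p divides one of the two norms, and by inertness both
    coordinates of that factor. *)
Lemma inert_primeO (p : nat) : prime p ->
  (forall a b, (p%:Z %| qnorm d a b)%Z -> (p%:Z %| a)%Z /\ (p%:Z %| b)%Z) ->
  primeO (p%:R : C).
Proof.
move=> pp inert; split; first exact: (inO_int p%:Z).
move=> _ _ [a [b ->]] [a' [b' ->]] dv.
have : (p %| absz (qnorm d a b) * absz (qnorm d a' b'))%N.
  have absE k l : absC (qint k l) ^+ 2 = (absz (qnorm d k l))%:R.
    have E := absC_qint k l; rewrite E.
    have: (0 : R) <= (qnorm d k l)%:~R by rewrite -E sqr_ge0.
    by rewrite ler0z => /gez0_abs {1}<-.
  have: (p ^ 2 %| absz (qnorm d a b) * absz (qnorm d a' b'))%N.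
    apply: dvdO_absC dv; first by rewrite absC_nat natrX.
    by rewrite absCM exprMn !absE natrM.
  by apply: dvdn_trans; rewrite dvdn_mulr.
rewrite Euclid_dvdM // => /orP [] H; [left|right]; apply/dvdO_int/inert;
  by rewrite dvdzE.
Qed.

(** The residue ring modulo P is the field of p elements: each element is congruent to an integer,
    and P divides an integer only if p does. Primality of p thus passes to P. *)
Lemma norm_primeO (p : nat) a b : prime p -> p%:Z = qnorm d a b ->
  primeO (qint a b).
Proof.
move=> pp Ep; set P := qint a b.
have PP : P * (P^*)%C = p%:R by rewrite mul_conjc absC_qint -Ep rmorph_nat.
have PcO : inO d (P^*)%C by apply/inO_conj/inO_qint.
have absP : absC P ^+ 2 = p%:R by rewrite absC_qint -Ep.
have dvP (k : int) : dvdO d P (p%:R * k%:~R).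
  by apply: dvdO_mulr; [exact: inO_int | exists ((P^*)%C)].
(* If p | b, then p | a^2, so p | a, and p^2 would divide N(P) = p. *)
have pNb : ~~ (p%:Z %| b)%Z.
  apply/negP => /dvdzP [b' Eb].
  have : (p%:Z %| a * a)%Z.
    have -> : a * a = p%:Z * (1 - b' * (t * a + m * b)).
      by rewrite mulrBr mulr1 {1}Ep /qnorm Eb; ring.
    by rewrite dvdz_mulr.
  rewrite dvdzE abszM Euclid_dvdM // orbb => /dvdnP [a' Ea].
  have {Ea} /dvdzP [c Ec] : (p%:Z %| a)%Z by rewrite dvdzE Ea dvdn_mull.
  have : p%:Z * (c ^+ 2 + t * c * b' + m * b' ^+ 2) = 1.
    apply: (@mulfI _ p%:Z); first by have := prime_gt0 pp; lia.
    by rewrite mulr1 {3}Ep /qnorm Ec Eb; ring.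
  move/(congr1 absz)/eqP; rewrite abszM muln_eq1 => /andP [/eqP p1 _].
  by have := prime_gt1 pp; rewrite -[p]/(absz p%:Z) p1.
have [u [v uv]] : exists u v : int, u * b + v * p = 1.
  have /eqP cop : coprimez b p by rewrite coprimezE /= coprime_sym prime_coprime // -dvdzE.
  by have [u [v E]] := Bezoutz b p; exists u, v; rewrite E cop.
(* [Z] surjects onto the residue ring, since [w = - u a] modulo [P] *)
have res x : inO d x -> exists k : int, dvdO d P (x - k%:~R).
  move=> [e [f ->]]; exists (e - f * u * a).
  have -> : e%:~R + f%:~R * w - (e - f * u * a)%:~R =
    P * ((f * u)%:~R) + p%:R * (v * f)%:~R * w.
    have -> : p%:R * (v * f)%:~R * w = f%:~R * (1 - u * b)%:~R * w.
      by rewrite -uv !(rmorphD, rmorphB, rmorphM) /=; ring.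
    by rewrite /P /qint !(rmorphD, rmorphB, rmorphM) /=; ring.
  apply: dvdO_add; last by apply: dvdO_mulr; [exists 0, 1; ring | exact: dvP].
  by exists (f * u)%:~R => //; exact: inO_int.
have dvint (k : int) : dvdO d P k%:~R -> (p%:Z %| k)%Z.
  move=> H; have : (p %| absz k ^ 2)%N.
    apply: dvdO_absC H => //; rewrite absC_sqr Re_intr Im_intr expr0n addr0.
    by rewrite natrX natr_absz intr_norm real_normK ?num_real.
  by rewrite dvdzE Euclid_dvdX // => /andP [].
split; first exact: inO_qint.
move=> y z yO zO yz; have [k Hk] := res _ yO; have [l Hl] := res _ zO.
have /dvint : dvdO d P (k * l)%:~R.
  (* The product kl differs from yz by a combination of y - k and z - l, all divisible by P. *)
  have -> : (k * l)%:~R = y * z + ((y - k%:~R) * (- z) + (z - l%:~R) * (- k%:~R)) :> C.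
    by rewrite rmorphM /=; ring.
  apply: dvdO_add => //; apply: dvdO_add; apply: dvdO_mulr => //; apply: inON => //.
  exact: inO_int.
have up x (j : int) : (p%:Z %| j)%Z -> dvdO d P (x - j%:~R) -> dvdO d P x.
  move=> /dvdzP [i ->] H; rewrite -[x](subrK (i * p)%:~R); apply: dvdO_add => //.
  by rewrite rmorphM mulrC /=; exact: dvP.
rewrite dvdzE abszM Euclid_dvdM // => /orP [] H; [left|right].
  by apply: up Hk; rewrite dvdzE.
by apply: up Hl; rewrite dvdzE.
Qed.

Lemma norm_eq_prime_power (p : nat) : prime p ->
  exists P e, [/\ primeO P, (0 < e)%N & absC (P ^+ e) = p%:R].
Proof.
move=> pp; have [[a [b E]]|H] := prime_norm_or_inert d p dH pp.
  exists (qint a b), 2; split=> //; first exact: norm_primeO E.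
  by rewrite absCX absC_qint -E.
exists p%:R, 1; split=> //; first exact: inert_primeO.
by rewrite expr1 absC_nat.
Qed.

End RingOfIntegers.

(** * Unitary divisors *)

Section UnitaryDivisors.
Variables (R : realType) (d : int).
Hypothesis dH : d \in heegner_list.
Local Notation C := R[i].

Lemma unitO_neq0 (u : C) : unitO d u -> u != 0.
Proof.
move=> [_ [v _ uv]]; apply/eqP => u0; move: uv; rewrite u0 mul0r => /eqP.
by rewrite eq_sym oner_eq0.
Qed.

Lemma dvdO_unitl (u c x : C) : unitO d u -> dvdO d c (u * x) -> dvdO d c x.
Proof.
move=> [_ [v vO uv]] [y yO E]; exists (y * v); first exact: inOM.
by rewrite mulrA -E mulrAC uv mul1r.
Qed.

Lemma relprimeO_unit (u v x y : C) : unitO d u -> unitO d v ->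
  relprimeO d x y -> relprimeO d (u * x) (v * y).
Proof. by move=> uU vU rxy c cO /(dvdO_unitl _ _ _ uU) cx /(dvdO_unitl _ _ _ vU); exact: rxy. Qed.

Lemma dvdO_trans (x y z : C) : dvdO d x y -> dvdO d y z -> dvdO d x z.
Proof.
by move=> [k kO ->] [l lO ->]; exists (k * l); rewrite ?mulrA //; exact: inOM.
Qed.

Lemma relprimeOC (x y : C) : relprimeO d x y -> relprimeO d y x.
Proof. by move=> rxy c cO cx cy; exact: rxy. Qed.

Lemma relprimeO_dvdl (x x' y : C) : dvdO d x' x -> relprimeO d x y ->
  relprimeO d x' y.
Proof. by move=> xx' rxy c cO cx cy; apply: rxy => //; exact: dvdO_trans xx'. Qed.

(** P divides xy but not y, so its factors can be pulled out of x one at a time. *)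
Lemma primeO_exp_dvd (P x y z : C) j : primeO R d P -> P != 0 -> inO d x ->
  inO d y -> inO d z -> ~ dvdO d P y -> x * y = P ^+ j * z ->
  exists x', [/\ inO d x', x = P ^+ j * x' & x' * y = z].
Proof.
move=> [PO Pp] P0 + yO zO Py; elim: j x => [|j IH] x xO.
  by rewrite expr0 mul1r => E; exists x; split; rewrite ?expr0 ?mul1r.
rewrite exprS -mulrA => E.
have [|[x1 x1O Ex]|//] := Pp _ _ xO yO.
  by rewrite E; exists (P ^+ j * z) => //; apply/inOM/zO/inOX/PO.
have [|x' [x'O Ex1 Ez]] := IH x1 x1O.
  by apply: (mulfI P0); rewrite -E Ex mulrA.
by exists x'; split=> //; rewrite Ex Ex1 mulrA.
Qed.

(** * The multiplicative lift of the positive integers *)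

Section Lift.
Variables (P : nat -> C) (e : nat -> nat).
Hypothesis P_prime : forall p, prime p -> primeO R d (P p).
Hypothesis e_gt0 : forall p, prime p -> (0 < e p)%N.
Hypothesis absC_P : forall p, prime p -> absC (P p ^+ e p) = p%:R.

(** A common cutoff [N] serves an integer and all its divisors. Composite indices and 0, 1
    contribute 1, since [logn] vanishes there. *)
Definition norm_lift N n : C := \prod_(0 <= p < N.+1) (P p ^+ e p) ^+ logn p n.

Lemma lift1 N : norm_lift N 1 = 1.
Proof. by apply: big1 => p _; rewrite logn1. Qed.

Lemma liftM N a b : (0 < a)%N -> (0 < b)%N ->
  norm_lift N (a * b) = norm_lift N a * norm_lift N b.
Proof.
move=> a0 b0; rewrite /norm_lift -big_split /=; apply: eq_bigr => p _.
by rewrite lognM // exprD.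
Qed.

Lemma lift_prime N p : prime p -> (p <= N)%N -> norm_lift N p = P p ^+ e p.
Proof.
move=> pp pN; rewrite /norm_lift (bigD1_seq p) ?iota_uniq ?mem_index_iota //=.
rewrite logn_prime // eqxx expr1 big1 ?mulr1 // => q qp.
by rewrite logn_prime // (negbTE qp).
Qed.

Lemma liftX N p k : prime p -> (p <= N)%N -> norm_lift N (p ^ k) = P p ^+ (e p * k).
Proof.
move=> pp pN; rewrite exprM -(lift_prime N) //.
elim: k => [|k IH]; first by rewrite lift1.
by rewrite expnS liftM ?expn_gt0 ?prime_gt0 // IH exprS.
Qed.

Lemma absC_lift N n : (0 < n <= N)%N -> absC (norm_lift N n) = n%:R.
Proof.
move=> /andP [n0 nN].
rewrite /norm_lift (big_morph _ absCM absC1) -[in RHS](partnT n0) (widen_partn _ nN).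
rewrite natr_prod; apply: eq_bigr => p _; rewrite absCX natrX.
case: (boolP (prime p)) => pp; first by rewrite absC_P.
by rewrite lognE (negbTE pp).
Qed.

Lemma inO_lift N n : inO d (norm_lift N n).
Proof.
apply: (big_ind (inO d)); [exact: inO1 | by move=> *; apply: inOM | move=> p _].
case: (boolP (prime p)) => pp; last by rewrite lognE (negbTE pp); exact: inO1.
by apply: (inOX _ _ dH); apply: (inOX _ _ dH); case: (P_prime p pp).
Qed.

Lemma P_neq0 p : prime p -> P p != 0.
Proof.
move=> pp; apply/eqP => P0; have := absC_P p pp.
rewrite P0 expr0n gtn_eqF ?e_gt0 // => /esym/eqP.
rewrite mulr0n (_ : absC 0 = 0) ?pnatr_eq0; last by apply/eqP; rewrite absC_eq0.
by move=> /eqP E; move: pp; rewrite E.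
Qed.

Lemma P_nonunit p : prime p -> ~ unitO d (P p).
Proof.
move=> pp PU; have := absC_P p pp.
have [PO _] := P_prime p pp.
rewrite absCX ((unitO_absC _ _ dH _ PO).1 PU) expr1n => /eqP.
by rewrite eq_sym pnatr_eq1 => /eqP E; move: pp; rewrite E.
Qed.

(** The squared modulus of a common divisor divides both a^2 and b^2, so it is 1. *)
Lemma lift_coprime N a b : (0 < a <= N)%N -> (0 < b <= N)%N -> coprime a b ->
  relprimeO d (norm_lift N a) (norm_lift N b).
Proof.
move=> aN bN cab c cO ca cb; apply/(unitO_absC _ _ dH) => //.
have [k Ek] := absC_inO _ _ dH _ cO.
have sqE n : (0 < n <= N)%N -> absC (norm_lift N n) ^+ 2 = (n ^ 2)%:R.
  by move=> nN; rewrite absC_lift // natrX.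
have ka := dvdO_absC _ _ dH _ _ _ _ Ek (sqE _ aN) ca.
have kb := dvdO_absC _ _ dH _ _ _ _ Ek (sqE _ bN) cb.
have : (k %| gcdn (a ^ 2) (b ^ 2))%N by rewrite dvdn_gcd ka.
have -> : gcdn (a ^ 2) (b ^ 2) = 1%N by apply/eqP; apply: coprimeXl; apply: coprimeXr.
rewrite dvdn1 => /eqP k1; apply/eqP.
by rewrite -sqrp_eq1 ?absC_ge0 // Ek k1.
Qed.

(** Induction on n, removing the full power p^j of a prime. By relative primality P_p divides only
    one of x and y, and that factor absorbs the whole power of P_p; hence x is, up to a unit, the
    lift of a unitary divisor. *)
Lemma lift_unitary N n x y : (0 < n <= N)%N -> inO d x -> inO d y ->
  relprimeO d x y -> x * y = norm_lift N n ->
  exists a b u, [/\ n = (a * b)%N, coprime a b, unitO d u & x = u * norm_lift N a].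
Proof.
have [k] := ubnP n; elim: k n x y => // k IH n x y nk /andP [n0 nN] xO yO rxy E.
have [n1|n_gt1|nE] := ltngtP n 1; first by move: n1 n0; rewrite ltnS leqn0 => /eqP ->.
  have pp := pdiv_prime n_gt1; set p := pdiv n in pp.
  have pN : (p <= N)%N by apply: leq_trans nN; exact/dvdn_leq/pdiv_dvd.
  have j0 : (0 < logn p n)%N by rewrite logn_gt0 mem_primes pp n0 pdiv_dvd.
  have [m cpm En] := pfactor_coprime pp n0; move: j0 En; move: (logn p n) => j j0 En.
  have m0 : (0 < m)%N by move: n0; rewrite En muln_gt0 => /andP [].
  have mn : (m < n)%N by rewrite En ltn_Pmulr // -(expn0 p) ltn_exp2l ?prime_gt1.
  have mk : (m < k)%N by apply: leq_trans mn _.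
  have mN : (0 < m <= N)%N by rewrite m0 (leq_trans (ltnW mn)).
  have pj0 : (0 < p ^ j)%N by rewrite expn_gt0 prime_gt0.
  have E' : x * y = P p ^+ (e p * j) * norm_lift N m.
    by rewrite E En liftM // liftX // mulrC.
  have [PO Pp] := P_prime p pp; have P0 := P_neq0 p pp.
  have mO : inO d (norm_lift N m) by exact: inO_lift.
  have PjO : inO d (P p ^+ (e p * j)) by exact: inOX.
  have copX b' : (b' %| m)%N -> coprime (p ^ j) b'.
    by move=> bm; apply/coprimeXl/(coprime_dvdr bm).
  have [] := Pp _ _ xO yO.
  - rewrite E'; have : (0 < e p * j)%N by rewrite muln_gt0 e_gt0.
    case: (e p * j)%N => // i _; rewrite exprS -mulrA; exists (P p ^+ i * norm_lift N m) => //.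
    by apply/inOM => //; exact: inOX.
  - move=> Px; have Py : ~ dvdO d (P p) y by move=> /(rxy _ PO Px); exact: P_nonunit.
    have [x' [x'O Ex Em]] := primeO_exp_dvd _ _ _ _ _ (P_prime p pp) P0 xO yO mO Py E'.
    have [|a [b [u [Eab cab uU Ea]]]] := IH m x' y mk mN x'O yO _ Em.
      by apply: relprimeO_dvdl rxy; exists (P p ^+ (e p * j)) => //; rewrite mulrC.
    have [a0 b0] : (0 < a /\ 0 < b)%N by move: m0; rewrite Eab muln_gt0 => /andP.
    exists (a * p ^ j)%N, b, u; split=> //.
    + by rewrite En Eab mulnAC.
    + by rewrite coprimeMl cab copX // Eab dvdn_mull.
    + by rewrite Ex Ea liftM // liftX //; ring.
  move=> Py; have Px : ~ dvdO d (P p) x by move=> /(rxy _ PO)/(_ Py); exact: P_nonunit.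
  have E'' : y * x = P p ^+ (e p * j) * norm_lift N m by rewrite mulrC.
  have [y' [y'O Ey Em]] := primeO_exp_dvd _ _ _ _ _ (P_prime p pp) P0 yO xO mO Px E''.
  have [||a [b [u [Eab cab uU Ea]]]] := IH m x y' mk mN xO y'O.
  - apply/relprimeOC/(relprimeO_dvdl _ _ _ _ (relprimeOC _ _ rxy)).
    by exists (P p ^+ (e p * j)) => //; rewrite mulrC.
  - by rewrite mulrC.
  exists a, (b * p ^ j)%N, u; split=> //; first by rewrite En Eab mulnA.
  by rewrite coprimeMr cab coprime_sym copX // Eab dvdn_mulr.
(* For n = 1 the factor x is a unit with inverse y. *)
exists 1%N, 1%N, x; split=> //; last by rewrite lift1 mulr1.
by split=> //; exists y => //; rewrite E nE lift1.
Qed.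

End Lift.
End UnitaryDivisors.

(** * Associates in A(d) *)

Section Argument.
Context {R : realType}.

(** The triple angle formula at cos(pi) = -1 gives (c + 1)(2c - 1)^2 = 0 for the cosine c, and c > 0
    excludes the first factor. *)
Lemma cos_pi3 : cos (pi / 3%:R : R) = 2^-1.
Proof.
have pi0 := pi_gt0 R; set a := pi / 3%:R.
have Ea : pi = a + a + a by rewrite /a; field.
have ca : 0 < cos a by apply: cos_gt0_pihalf; rewrite /a; apply/andP; split; lra.
have := cospi R; rewrite Ea !cosD !sinD => E.
have S := cos2Dsin2 a.
have : (cos a + 1) * (2 * cos a - 1) ^+ 2 = 0.
  have -> : (cos a + 1) * (2 * cos a - 1) ^+ 2 =
     4 * cos a ^+ 3 - 3 * cos a + 1 by ring.
  have Es : sin a ^+ 2 = 1 - cos a ^+ 2 by lra.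
  have : cos a ^+ 3 - 3 * cos a * sin a ^+ 2 = -1 by rewrite -E; ring.
  rewrite Es => E'; have -> : 4 * cos a ^+ 3 - 3 * cos a + 1 =
    cos a ^+ 3 - 3 * cos a * (1 - cos a ^+ 2) + 1 by ring.
  by rewrite E' addNr.
move/eqP; rewrite mulf_eq0 sqrf_eq0 => /orP [] /eqP H; lra.
Qed.

(** Cosine decreases on [0, pi], so an upper bound on the angle is a lower bound on Re z / |z|; the
    angle itself is the [acos] of that quotient. *)
Lemma arg_ltP (z : R[i]) (hi : R) : z != 0 -> 0 < hi <= pi ->
  arg_lt z hi <-> 0 <= complex.Im z /\ absC z * cos hi < complex.Re z.
Proof.
move=> z0 /andP [hi0 hipi].
have az : 0 < absC z by rewrite lt0r absC_eq0 z0 absC_ge0.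
split=> [[th [th0 [thhi [-> ->]]]]|[Im0 Reb]].
  split; first by rewrite mulr_ge0 ?absC_ge0 // sin_ge0_pi // th0 (le_trans (ltW thhi)).
  by rewrite ltr_pM2l // ltr_cos // in_itv /= ?th0 ?(ltW hi0) // (le_trans (ltW thhi)).
have E := absC_sqr z.
set c := complex.Re z / absC z.
have cE : complex.Re z = absC z * c by rewrite /c mulrC divfK ?gt_eqF.
have c1 : -1 <= c <= 1.
  rewrite -ler_norml -(ler_pXn2r (n := 2)) ?nnegrE ?normr_ge0 // real_normK ?num_real // expr1n.
  have : 0 <= absC z ^+ 2 * (1 - c ^+ 2).
    by rewrite mulrBr mulr1 -exprMn -cE E addrC addKr sqr_ge0.
  by rewrite pmulr_rge0 ?exprn_gt0 // subr_ge0.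
have [/andP [th0 thpi] cth] := acos_def c1.
exists (acos c); split=> //; split; last split.
- rewrite -ltr_cos ?in_itv /= ?th0 ?(ltW hi0) // cth.
  by move: Reb; rewrite cE ltr_pM2l.
- by rewrite cth.
have s0 : 0 <= sin (acos c) by apply: sin_ge0_pi; rewrite th0.
apply/eqP; rewrite -(eqrXn2 (n := 2)) // ?mulr_ge0 ?absC_ge0 //.
rewrite exprMn sin2cos2 cth mulrBr mulr1 -exprMn -cE E.
by apply/eqP; ring.
Qed.

End Argument.

(** * Sectors and units in coordinates *)

Section Sectors.
Variables (R : realType) (d : int).
Hypothesis dH : d \in heegner_list.
Local Notation C := R[i].

(** For [d] = -1 and -3 the sector is the cone between 1 (included) and [omega] (excluded), as
    [omega] has argument pi/2 or pi/3. Otherwise it is the open upper half plane with the positive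
    real axis. *)
Definition in_sector (a b : int) : bool :=
  if (d == -1) || (d == -3) then (0 < a) && (0 <= b)
  else (0 < b) || (b == 0) && (0 < a).

Lemma qint_eq0 a b : (qint R d a b == 0) = (a == 0) && (b == 0).
Proof.
apply/eqP/andP => [E|[/eqP -> /eqP ->]]; last by rewrite /qint mul0r addr0.
have [|-> ->] // := qint_inj R d dH a b 0 0.
by rewrite E /qint mul0r addr0.
Qed.

Lemma inA_qint a b : inA d (qint R d a b) <-> in_sector a b.
Proof.
have w0 := Im_omega_gt0 R d dH.
have [w1 _ _] := omega_ReIm R d dH.
have pi0 := pi_gt0 R.
have E := absC_qint R d dH a b.
have Zge := absC_ge0 (qint R d a b).
have red hi : 0 < hi <= pi -> arg_bound R d = hi -> inA d (qint R d a b) <->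
    ~~ ((a == 0) && (b == 0)) /\
    (0 <= b /\ absC (qint R d a b) * cos hi < a%:~R + b%:~R * complex.Re (omega R d)).
  move=> hiI hiE; rewrite /inA hiE -qint_eq0; split.
    move=> [_ [z0 /(arg_ltP _ _ z0 hiI)]]; rewrite Re_qint // Im_qint //.
    by rewrite pmulr_lge0 // ler0z.
  move=> [z0 H]; split; first by exists a, b.
  split=> //; apply/(arg_ltP _ _ z0 hiI); rewrite Re_qint // Im_qint //.
  by rewrite pmulr_lge0 // ler0z.
rewrite /in_sector; case: (eqVneq d (-1)) => [d1|d1] /=.
  rewrite (red (pi / 2%:R)) /arg_bound ?d1 //; last by apply/andP; split; lra.
  rewrite cos_pihalf mulr0.
  have -> : complex.Re (omega R (-1)) = 0 by move: w1; rewrite d1 /tr_omega /=; lra.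
  by rewrite mulr0 addr0 ltr0z; lia.
case: (eqVneq d (-3)) => [d3|d3] /=.
  rewrite (red (pi / 3%:R)) /arg_bound ?d3 //; last by apply/andP; split; lra.
  rewrite cos_pi3.
  have -> : complex.Re (omega R (-3)) = 2^-1 by move: w1; rewrite d3 /tr_omega /=; lra.
  have -> : absC (qint R (-3) a b) / 2 < a%:~R + b%:~R / 2 =
      (absC (qint R d a b) < (2 * a + b)%:~R :> R).
    rewrite d3 rmorphD rmorphM /=; apply/idP/idP; lra.
  (* Squaring turns the condition into 3a(a + b) > 0, which together with b >= 0 and 2a + b > 0
     amounts to a > 0. *)
  have sqE : 0 <= 2 * a + b -> (absC (qint R d a b) < (2 * a + b)%:~R :> R) =
      (qnorm d a b < (2 * a + b) ^+ 2).
    move=> ab0; rewrite -(ltr_pXn2r (n := 2)) ?nnegrE ?ler0z // E.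
    by rewrite -rmorphXn /= ltr_int.
  have q3 : qnorm d a b = a ^+ 2 + a * b + b ^+ 2.
    by rewrite d3 -[qnorm _ _ _]/(a ^+ 2 + 1 * a * b + 1 * b ^+ 2); ring.
  split.
    move=> [_ [b0 H]]; have ab0 : 0 < 2 * a + b by rewrite -(ltr0z R); lra.
    move: H; rewrite (sqE (ltW ab0)) b0 andbT q3; nia.
  move=> /andP [a0 b0]; rewrite sqE; last by lia.
  by rewrite q3; split; [lia | split=> //; nia].
rewrite (red pi) /arg_bound ?(negbTE d1) ?(negbTE d3) ?pi0 ?lexx //.
(* The condition -|z| < Re z removes exactly 0 and the negative real axis from the closed upper half
   plane. *)
rewrite cospi mulrN1 ltrNl.
set z := absC _ in E Zge *; set r := _ + _.
have Er : z ^+ 2 = r ^+ 2 + (b%:~R * complex.Im (omega R d)) ^+ 2.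
  by rewrite /z absC_sqr Re_qint // Im_qint.
have rE : b = 0 -> r = a%:~R by rewrite /r => ->; rewrite mul0r addr0.
case: (ltrgtP b 0) => [b0|b0|b0] /=.
- by split=> [[_ [b0' _]]|//]; lia.
- split=> // _; split; first by rewrite andbF.
  split=> //; rewrite ltNge; apply/negP => zr.
  have : z ^+ 2 <= r ^+ 2 by rewrite -[r ^+ 2]sqrrN ler_pXn2r // nnegrE (le_trans Zge).
  by rewrite Er gerDl leNgt exprn_even_gt0 //= mulf_eq0 negb_or intr_eq0 (gt_eqF b0) (gt_eqF w0).
have zr : z = `|r|.
  apply/eqP; rewrite -(eqrXn2 (n := 2)) ?normr_ge0 // real_normK ?num_real //.
  by rewrite Er b0 mul0r expr0n addr0.
rewrite zr (rE b0) andbT -intr_norm -rmorphN ltr_int; split; first by lia.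
by move=> a0; split; lia.
Qed.

Lemma unitO_qint a b : unitO d (qint R d a b) <-> qnorm d a b = 1.
Proof.
rewrite (unitO_absC _ _ dH); last by exists a, b.
split=> [E|E].
  have := absC_qint R d dH a b; rewrite E expr1n => /esym.
  exact: (@intr_inj R _ 1).
apply/eqP; rewrite -sqrp_eq1 ?absC_ge0 //.
by rewrite absC_qint // E.
Qed.

Lemma omega_coeffs_small :
  [\/ [/\ d = -1, tr_omega d = 0 & nm_omega d = 1],
      [/\ d = -3, tr_omega d = 1 & nm_omega d = 1]
   | [/\ d != -1, d != -3 & 4 < 4 * nm_omega d - tr_omega d ^+ 2]].
Proof.
case: (eqVneq d (-1)) => [->|d1]; first by constructor 1.
case: (eqVneq d (-3)) => [->|d3]; first by constructor 2.
constructor 3; split=> //.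
have /allP H : all (fun d => [|| d == -1, d == -3 |
  4 < 4 * nm_omega d - tr_omega d ^+ 2]) heegner_list by vm_compute.
by have := H d dH; rewrite (negbTE d1) (negbTE d3).
Qed.

(** The coordinates are those of (e + f omega)(a + b omega). Rotations of the sector by the 4, 6 or
    2 units cover the nonzero elements, and each disjunct is one such rotation. *)
Lemma exists_associate a b : ~~ ((a == 0) && (b == 0)) ->
  exists e f, qnorm d e f = 1 /\ in_sector (e * a - f * b * nm_omega d)
              (e * b + f * a + f * b * tr_omega d).
Proof.
rewrite /in_sector /qnorm => ab.
case: omega_coeffs_small => [[-> -> ->]|[-> -> ->]|[/negbTE -> /negbTE -> _]] /=.
- have : [|| (0 < a) && (0 <= b), (0 < b) && (0 <= - a),
    (0 < - a) && (0 <= - b) | (0 < - b) && (0 <= a)] by lia.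
  case/or4P => H; [exists 1, 0|exists 0, (-1)|exists (-1), 0|exists 0, 1]; (split; [by [] | lia]).
- have : [|| (0 < a) && (0 <= b), (0 < - b) && (0 <= a + b),
    (0 < - (a + b)) && (0 <= a) |
    [|| (0 < - a) && (0 <= - b), (0 < b) && (0 <= - (a + b)) |
    (0 < a + b) && (0 <= - a)]] by lia.
  case/or4P => [H|H|H|/or3P [] H]; [exists 1, 0|exists 0, 1|exists (-1), 1|
    exists (-1), 0|exists 0, (-1)|exists 1, (-1)]; (split; [by [] | lia]).
- have : ((0 < b) || (b == 0) && (0 < a)) || ((0 < - b) || (b == 0) && (0 < - a))
    by lia.
  by case/orP => H; [exists 1, 0|exists (-1), 0]; (split; [ring | lia]).
Qed.

Lemma unique_associate a b e f : in_sector a b -> qnorm d e f = 1 ->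
  in_sector (e * a - f * b * nm_omega d)
            (e * b + f * a + f * b * tr_omega d) -> e = 1 /\ f = 0.
Proof.
rewrite /in_sector /qnorm.
case: omega_coeffs_small => [[-> -> ->]|[-> -> ->]|[/negbTE -> /negbTE -> D]] /=.
- move=> S N.
  have : [|| (e == 1) && (f == 0), (e == -1) && (f == 0), (e == 0) && (f == 1) |
    (e == 0) && (f == -1)] by nia.
  by case/or4P => /andP [/eqP Ee /eqP Ef]; rewrite Ee Ef; lia.
- move=> S N.
  have [e1 f1] : -1 <= e <= 1 /\ -1 <= f <= 1 by nia.
  have : [|| e == 0, e == 1 | e == -1] by lia.
  have : [|| f == 0, f == 1 | f == -1] by lia.
  by case/or3P => /eqP Ef; case/or3P => /eqP Ee; move: N; rewrite Ee Ef; lia.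
move=> S N.
have f0 : f = 0.
  (* This is 4N(e + f omega) with the square completed; the coefficient of f^2 exceeds 4, so f = 0
     and the units are 1 and -1. *)
  have E : (2 * e + tr_omega d * f) ^+ 2 + (4 * nm_omega d - tr_omega d ^+ 2) * f ^+ 2 = 4.
    by transitivity (4 * qnorm d e f); [rewrite /qnorm; ring | rewrite [qnorm _ _ _]N].
  have S1 := sqr_ge0 (2 * e + tr_omega d * f).
  case: (eqVneq f 0) => // fN0; have : 1 <= f ^+ 2 by rewrite -gtz0_ge1 exprn_even_gt0.
  nia.
move: N S; rewrite f0 => N; have : (e == 1) || (e == -1) by nia.
by case/orP => /eqP ->; lia.
Qed.

Lemma inA_associate (x : C) : inO d x -> x != 0 ->
  exists2 u, unitO d u & inA d (u * x).
Proof.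
move=> [a [b ->]]; rewrite -/(qint R d a b) qint_eq0 => ab.
have [e [f [N S]]] := exists_associate a b ab.
exists (qint R d e f); first exact/unitO_qint.
by rewrite qint_mul //; exact/inA_qint.
Qed.

Lemma inA_associate_eq (x u : C) : inA d x -> unitO d u -> inA d (u * x) -> u = 1.
Proof.
move=> xA uU; have [[a [b Ex]] _] := xA; have [[e [f Eu]] _] := uU.
move: xA uU; rewrite Ex Eu -!/(qint R d _ _) qint_mul //.
move=> /inA_qint S /unitO_qint N /inA_qint S'.
by have [-> ->] := unique_associate _ _ _ _ S N S'; rewrite /qint mul0r addr0.
Qed.

End Sectors.

(** * The injection *)

Lemma exists_prime_powers (R : realType) (d : int) : d \in heegner_list ->
  exists (P : nat -> R[i]) (e : nat -> nat), forall p, prime p ->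
    [/\ primeO R d (P p), (0 < e p)%N & absC (P p ^+ e p) = p%:R].
Proof.
move=> dH.
have /choice [f Hf] : forall p, exists q : R[i] * nat, prime p ->
    [/\ primeO R d q.1, (0 < q.2)%N & absC (q.1 ^+ q.2) = p%:R].
  move=> p.
  case: (boolP (prime p)) => pp; last by exists (0, 0%N).
  by have [P [e H]] := norm_eq_prime_power R d dH p pp; exists (P, e).
by exists (fun p => (f p).1), (fun p => (f p).2).
Qed.

Lemma unitO_mul (R : realType) (d : int) (u v : R[i]) : d \in heegner_list ->
  unitO d u -> unitO d v -> unitO d (u * v).
Proof.
move=> dH [uO [u' u'O uu']] [vO [v' v'O vv']]; split; first exact: inOM.
by exists (u' * v'); [exact: inOM | rewrite mulrACA uu' vv' mulr1].
Qed.

Lemma unitO_inv (R : realType) (d : int) (u : R[i]) : unitO d u ->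
  unitO d u^-1.
Proof.
move=> uU; have u0 := unitO_neq0 _ _ _ uU; have [uO [v vO uv]] := uU.
have -> : u^-1 = v by apply: (mulfI u0); rewrite uv divff.
by split=> //; exists u; rewrite // mulrC.
Qed.

(** Each lift has an associate [rep c] in A(d). The map c to [rep c] sends the unitary divisors of n
    bijectively to the x in [diamond] relation with [rep n], and |[rep c]| = c, so the two divisor
    sums agree. *)
Lemma exists_unitary_lift (R : realType) (d : int) (n : nat) :
  d \in heegner_list -> (0 < n)%N ->
  exists z : R[i], [/\ inA d z, absC z = n%:R &
    I1s d z = (usigma n)%:R / n%:R].
Proof.
move=> dH n0; have [P [e H]] := exists_prime_powers R d dH.
have Pp p : prime p -> primeO R d (P p) by case/H.
have e0 p : prime p -> (0 < e p)%N by case/H.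
have aP p : prime p -> absC (P p ^+ e p) = p%:R by case/H.
pose L := norm_lift R P e n.
have LO c : inO d (L c) := inO_lift _ _ dH _ _ Pp n c.
have LA c : (0 < c <= n)%N -> absC (L c) = c%:R := absC_lift _ _ _ aP n c.
have /choice [rep Hrep] : forall c, exists x : R[i], (0 < c <= n)%N ->
    inA d x /\ exists2 u, unitO d u & x = u * L c.
  move=> c.
  case: (boolP (0 < c <= n)%N) => cn; last by exists 0.
  have [|u uU uA] := inA_associate R d dH (L c) (LO c).
    by rewrite -absC_eq0 LA // pnatr_eq0 -lt0n; case/andP: cn.
  by exists (u * L c) => _; split=> //; exists u.
have repA c : (0 < c <= n)%N -> absC (rep c) = c%:R.
  move=> cn; have [_ [u uU ->]] := Hrep c cn; have [uO _] := uU.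
  by rewrite absCM ((unitO_absC _ _ dH _ uO).1 uU) mul1r LA.
have nn : (0 < n <= n)%N by rewrite n0 leqnn.
have [zA [u uU Ez]] := Hrep n nn.
have factor_le a b : n = (a * b)%N -> (0 < a <= n)%N /\ (0 < b <= n)%N.
  move=> E; move: (n0); rewrite {1}E muln_gt0 => /andP [a0 b0].
  by rewrite a0 b0 E leq_pmulr // leq_pmull.
pose s := [seq c <- divisors n | coprime c (n %/ c)].
have sP a b : n = (a * b)%N -> coprime a b -> a \in s.
  move=> E cab; have [/andP [a0 _] _] := factor_le a b E.
  by rewrite mem_filter -dvdn_divisors // E mulKn // cab dvdn_mulr.
have sE c : c \in s -> exists2 c', n = (c * c')%N & coprime c c'.
  rewrite mem_filter -dvdn_divisors // => /andP [cop /dvdnP [k E]].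
  have [_ /andP [c0 _]] := factor_le k c E.
  by exists k; rewrite ?E 1?mulnC //; move: cop; rewrite E mulnK.
have diamondP x : diamond d x (rep n) <-> exists2 c, c \in s & x = rep c.
  split=> [[xA [[y yO Exy]]]|[c /sE [c' E cop] ->]].
    have [xO [x0 _]] := xA; rewrite {1}Exy mulrC mulKf // => rxy.
    (* The unit relating [rep n] to [L n] is moved into the cofactor y, so that [lift_unitary]
       applies to x. *)
    have uV := unitO_inv _ _ _ uU; have u0 := unitO_neq0 _ _ _ uU.
    have E : x * (u^-1 * y) = L n.
      by rewrite mulrCA -Exy Ez mulKf.
    have yO' : inO d (u^-1 * y) by apply: inOM => //; case: uV.
    have r' : relprimeO d x (u^-1 * y).
      move=> c cO cx /(dvdO_unitl _ _ dH _ _ _ uV); exact: rxy.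
    have [a [b [v [Eab cab vU Ex]]]] :=
      lift_unitary _ _ dH _ _ Pp e0 aP n n x _ nn xO yO' r' E.
    exists a; first exact: sP Eab cab.
    have [an _] := factor_le a b Eab.
    have [rA [w wU Ew]] := Hrep a an.
    have v0 := unitO_neq0 _ _ _ vU.
    have Ewx : rep a = w * v^-1 * x by rewrite Ew Ex mulrA divfK.
    have wvU : unitO d (w * v^-1) by apply: unitO_mul => //; exact: unitO_inv.
    (* [rep a] and x are associates lying in A(d), hence equal. *)
    rewrite Ewx in rA *.
    by rewrite (inA_associate_eq _ _ dH _ _ xA wvU rA) mul1r.
  have [cn c'n] := factor_le c c' E.
  have [rA [w wU Ew]] := Hrep c cn; have w0 := unitO_neq0 _ _ _ wU.
  have [_ [r0 _]] := rA.
  have uwU : unitO d (u * w^-1) by apply: unitO_mul => //; exact: unitO_inv.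
  have Enc : rep n = rep c * (u * w^-1 * L c').
    have /andP [c0 _] := cn; have /andP [c'0 _] := c'n.
    rewrite Ez Ew {1}E /L liftM // -/L.
    by rewrite mulrACA [w * _]mulrC divfK // mulrA.
  split=> //; split.
    by exists (u * w^-1 * L c') => //; apply: inOM => //; case: uwU.
  rewrite Enc mulrC mulKf // Ew; apply: (relprimeO_unit _ _ dH) => //.
  exact: (lift_coprime _ _ dH _ _ aP).
have s_le c : c \in s -> (0 < c <= n)%N.
  by move=> /sE [c' E _]; have [] := factor_le c c' E.
exists (rep n); split=> //; first exact: repA.
rewrite /I1s repA //; congr (_ / _).
have -> : delta1s d (rep n) = \sum_(x <- [seq rep c | c <- s]) absC x.
  (* Distinct c give representatives of distinct modulus, so the list has no repetition. *)
  rewrite fsbig_seq; last first.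
    rewrite map_inj_in_uniq ?filter_uniq ?divisors_uniq // => a b /s_le an /s_le bn E.
    by apply/eqP; rewrite -(eqr_nat R) -!repA // E.
  suff <- : [set x | diamond d x (rep n)]%classic =
    [set` [seq rep c | c <- s]]%classic by [].
  apply/seteqP; split=> x /=; first by move=> /diamondP [c cs ->]; exact: map_f.
  by move=> /mapP Hx; apply/diamondP.
rewrite big_map /usigma natr_sum -[in RHS]big_filter.
by apply: eq_big_seq => c /s_le cn; rewrite repA.
Qed.

Theorem theorem2p6 (R : realType) (b : rat) (d : int) :
  1 < b -> d \in heegner_list ->
  exists g : nat -> R[i],
    (forall n, Uset b n -> Vset d b (g n)) /\
    (forall m n, Uset b m -> Uset b n -> g m = g n -> m = n).
Proof.
move=> _ dH.
have /choice [g Hg] : forall n, exists z : R[i], (0 < n)%N ->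
    [/\ inA d z, absC z = n%:R & I1s d z = (usigma n)%:R / n%:R].
  move=> n.
  (* The value at 0 is a placeholder, as 0 lies outside [Uset b]. *)
  case: (posnP n) => [->|n0]; first by exists 0.
  by have [z Hz] := exists_unitary_lift R d n dH n0; exists z.
exists g; split=> [n [n0 E]|m n [m0 _] [n0 _] E].
  have [gA _ gI] := Hg n n0; split=> //; rewrite gI.
  have n0' : (n%:R : R) != 0 by rewrite pnatr_eq0 -lt0n.
  apply: (mulIf n0'); rewrite divfK //.
  by rewrite -(ratr_nat R (usigma n)) E rmorphM /= ratr_nat.
have [_ am _] := Hg m m0; have [_ an _] := Hg n n0.
by apply/eqP; rewrite -(eqr_nat R) -am -an E.
Qed.
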